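(* Let $K$ and $L$ be infinitely distributive lattices and let $T:K\to L$ be a lattice homomorphism. Define $$\hat T:\mathfrak I_K\to\mathfrak I_L,\qquad A\mapsto (T(A))^{\sigma_L}.$$ (i) $\hat T$ is a meet homomorphism. (ii) If $T$ preserves every join that exists in its domain, then so does $\hat T$.
   Context: A lattice $L$ is infinitely distributive if whenever $\bigvee A$ exists, $x\wedge\bigvee A=\bigvee_{a\in A}(x\wedge a)$ for every $x\in L$, and whenever $\bigwedge A$ exists, $x\vee\bigwedge A=\bigwedge_{a\in A}(x\vee a)$ for every $x\in L$. A net $(x_\gamma)$ in $L$ order converges to $x\in L$ if there are a directed set $M\subseteq L$ and a filtered (downward directed) set $N\subseteq L$ with $\bigvee M=x=\bigwedge N$ such that for every $(m,n)\in M\times N$ the net is eventually in the interval $[m,n]$. A subset of $L$ is $O$-closed if it equals the set of all order limits of nets in it. An (order) ideal of $L$ is a downset closed under finite joins. For $A\subseteq L$, $A^{\sigma_L}$ is the smallest $O$-closed ideal of $L$ containing $A$. $\mathfrak I_L$ denotes the collection of all $O$-closed ideals of $L$ ordered by inclusion; for infinitely distributive $L$ it is a complete lattice with $\bigwedge_i A_i=\bigcap_iA_i$ and $\bigvee_iA_i=(\bigcup_iA_i)^{\sigma_L}$. The same notation is used for $K$. A meet homomorphism is a map preserving binary meets: $\hat T(A\wedge B)=\hat T(A)\wedge\hat T(B)$ for all $A,B\in\mathfrak I_K$. A map between lattices preserves every join that exists in its domain if, whenever a subset $S$ of the domain has a supremum there, the image of that supremum is the supremum of the image of $S$; for $\hat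 T$ this says $\hat T\bigl(\bigvee_i^{\mathfrak I_K}A_i\bigr)=\bigvee_i^{\mathfrak I_L}\hat T(A_i)$ for every family $\{A_i:i\in I\}\subseteq\mathfrak I_K$. *)

(* Defs.v *)
From HB Require Import structures.
From mathcomp Require Import all_boot all_order.
From mathcomp Require Import boolp classical_sets cardinality.

Set Implicit Arguments.
Unset Strict Implicit.
Unset Printing Implicit Defensive.

Import Order.TTheory.

Local Open Scope classical_set_scope.

(* Infima and suprema are the relations [infimums A x] and [supremums A x] of
   classical_sets, which make sense when the bound need not exist. *)

Definition infinitely_distributive d (L : latticeType d) : Prop :=
  (forall (A : set L) (a x : L), supremums A a ->
     supremums [set Order.meet x b | b in A] (Order.meet x a)) /\
  (forall (A : set L) (a x : L), infimums A a ->
     infimums [set Order.join x b | b in A] (Order.join x a)).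

(* Directed and filtered sets are nonempty, as usual for nets. *)
Definition directed_for (I : Type) (R : I -> I -> Prop) (D : set I) : Prop :=
  D !=set0 /\
  forall i j, D i -> D j -> exists k, [/\ D k, R i k & R j k].

Definition directed_preorder (I : Type) (R : I -> I -> Prop) : Prop :=
  [/\ forall i, R i i,
      forall i j k, R i j -> R j k -> R i k
    & directed_for R setT].

Section OrderConvergence.
Context d (L : latticeType d).
Implicit Types (A : set L) (x : L).

(* The net is [u : I -> L], its index preorder is [R]. *)
Definition order_converges (I : Type) (R : I -> I -> Prop) (u : I -> L) x :=
  exists M N : set L,
    [/\ directed_for (fun a b => (a <= b)%O) M,
        directed_for (fun a b => (b <= a)%O) N,
        supremums M x,
        infimums N x
      & forall m n, M m -> N n ->
          exists i0, forall i, R i0 i -> (m <= u i <= n)%O].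

Definition order_limits A : set L :=
  [set x | exists (I : Type) (R : I -> I -> Prop) (u : I -> L),
     [/\ directed_preorder R, forall i, A (u i) & order_converges R u x]].

Definition O_closed A : Prop := A = order_limits A.

(* Nonempty finite joins always exist in L.  The finite set F may be empty: its
   join exists exactly when L has a bottom element, which then belongs to every
   ideal.  When L has no bottom the empty set is an ideal, so that ideals are
   closed under arbitrary intersections in all cases. *)
Definition order_ideal A : Prop :=
  (forall x y, (y <= x)%O -> A x -> A y) /\
  (forall (F : set L) x, finite_set F -> F `<=` A -> supremums F x -> A x).

Definition O_closed_ideal A : Prop := order_ideal A /\ O_closed A.

Lemma sub_order_limits A : A `<=` order_limits A.
Proof.
move=> x Ax; exists unit, (fun _ _ => True), (fun=> x); split=> //.
  by split=> //; split=> [|i j _ _]; exists tt.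
exists [set x], [set x]; split.
- by split=> [|_ _ -> ->]; exists x.
- by split=> [|_ _ -> ->]; exists x.
- by rewrite supremums1.
- by rewrite infimums1.
- by move=> m n -> ->; exists tt => i _; rewrite lexx.
Qed.

Lemma order_limitsS A B : A `<=` B -> order_limits A `<=` order_limits B.
Proof.
by move=> AB x [I [R [u [dR Au ux]]]]; exists I, R, u; split=> // i; exact: AB.
Qed.

Lemma O_closed_ideal_bigcap (F : set (set L)) :
  (forall A, F A -> O_closed_ideal A) -> O_closed_ideal (\bigcap_(A in F) A).
Proof.
move=> FI; split; first split.
- move=> x y yx Fx A FA; have [[dA _] _] := FI A FA.
  exact: dA yx (Fx A FA).
- move=> G x finG GF Gx A FA; have [[_ jA] _] := FI A FA.
  by apply: jA Gx => // y /GF; apply.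
- rewrite /O_closed; apply/seteqP; split; first exact: sub_order_limits.
  move=> x Fx A FA; have [_ ->] := FI A FA.
  by apply: order_limitsS Fx => y; apply.
Qed.

Definition sigma_closure A : set L := smallest O_closed_ideal A.

Lemma O_closed_ideal_sigma A : O_closed_ideal (sigma_closure A).
Proof. by apply: O_closed_ideal_bigcap => B []. Qed.

Lemma sub_sigma A : A `<=` sigma_closure A.
Proof. exact: sub_gen_smallest. Qed.

Lemma sigma_min A J : O_closed_ideal J -> A `<=` J -> sigma_closure A `<=` J.
Proof. exact: smallest_sub. Qed.

End OrderConvergence.

Record OIdeal d (L : latticeType d) := MkOIdeal {
  oideal_set :> set L;
  oidealP : `[< O_closed_ideal oideal_set >] }.

HB.instance Definition _ d (L : latticeType d) :=
  [isSub for @oideal_set d L].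
HB.instance Definition _ d (L : latticeType d) :=
  [Choice of OIdeal L by <:].
(* [set L] is ordered by inclusion; OIdeal L inherits that order. *)
HB.instance Definition _ d (L : latticeType d) :=
  [SubChoice_isSubPOrder of OIdeal L by <: with set_display].

Section OIdealLattice.
Context d (L : latticeType d).
Implicit Types A B C : OIdeal L.

Lemma le_oidealE A B : (A <= B)%O <-> (A : set L) `<=` B.
Proof. by rewrite -Order.le_val; split=> /asboolP. Qed.

Lemma oideal_closed A : O_closed_ideal A.
Proof. exact/asboolP/oidealP. Qed.

Definition oideal_sigma (X : set L) : OIdeal L :=
  MkOIdeal (asboolT (O_closed_ideal_sigma X)).

Lemma oideal_sigma_le (X : set L) A : (oideal_sigma X <= A)%O <-> X `<=` A.
Proof.
rewrite le_oidealE; split=> [sXA|XA].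
  exact: subset_trans (@sub_sigma _ _ X) sXA.
exact: sigma_min (oideal_closed A) XA.
Qed.

Lemma O_closed_idealI (X Y : set L) :
  O_closed_ideal X -> O_closed_ideal Y -> O_closed_ideal (X `&` Y).
Proof.
move=> XI YI; rewrite (_ : X `&` Y = \bigcap_(Z in [set X; Y]) Z); last first.
  by rewrite bigcap_setU !bigcap_set1.
by apply: O_closed_ideal_bigcap => Z [] ->.
Qed.

Definition oideal_meet A B : OIdeal L :=
  MkOIdeal (asboolT (O_closed_idealI (oideal_closed A) (oideal_closed B))).

Definition oideal_join A B : OIdeal L := oideal_sigma (A `|` B).

Fact oideal_meetP A B C :
  (A <= oideal_meet B C)%O = (A <= B)%O && (A <= C)%O.
Proof.
apply/idP/andP.
  by move=> /le_oidealE; rewrite subsetI => -[? ?]; split; apply/le_oidealE.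
by move=> [/le_oidealE AB /le_oidealE AC]; apply/le_oidealE; rewrite subsetI.
Qed.

Fact oideal_joinP A B C :
  (oideal_join A B <= C)%O = (A <= C)%O && (B <= C)%O.
Proof.
apply/idP/andP.
  move=> /oideal_sigma_le; rewrite subUset => -[? ?].
  by split; apply/le_oidealE.
move=> [/le_oidealE AC /le_oidealE BC].
by apply/oideal_sigma_le; rewrite subUset.
Qed.

HB.instance Definition _ :=
  Order.POrder_MeetJoin_isLattice.Build set_display (OIdeal L)
    oideal_meetP oideal_joinP.

Lemma oideal_meetE A B :
  (Order.meet A B : OIdeal L) = A `&` B :> set L.
Proof. by []. Qed.

Lemma oideal_infimums (F : set (OIdeal L)) A :
  infimums F A <-> A = \bigcap_(B in F) B :> set L.
Proof.
have bI : O_closed_ideal (\bigcap_(B in F) (B : set L)).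
  rewrite -(bigcap_image F (@oideal_set _ L) id).
  by apply: O_closed_ideal_bigcap => _ [B _ <-]; exact: oideal_closed.
split=> [[lbA gA]|AE].
  apply/seteqP; split=> [x Ax B FB|].
    exact: (le_oidealE _ _).1 (lbA _ FB) x Ax.
  apply: (le_oidealE (MkOIdeal (asboolT bI)) A).1; apply: gA => B FB.
  by apply/le_oidealE => x; apply.
split=> [B FB|B lbB]; apply/le_oidealE => x.
  by rewrite AE; apply.
by move=> Bx; rewrite AE => C FC; exact: (le_oidealE _ _).1 (lbB _ FC) x Bx.
Qed.

Lemma oideal_supremums (F : set (OIdeal L)) A :
  supremums F A <-> A = sigma_closure (\bigcup_(B in F) B) :> set L.
Proof.
have ubE C : ubound F C <-> (oideal_sigma (\bigcup_(B in F) B) <= C)%O.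
  rewrite oideal_sigma_le; split=> [ubC x [B FB Bx]|sC B FB].
    exact: (le_oidealE _ _).1 (ubC _ FB) x Bx.
  by apply/le_oidealE => x Bx; apply: sC; exists B.
split=> [[/ubE ubA lA]|AE].
  suff -> : A = oideal_sigma (\bigcup_(B in F) B) by [].
  by apply/le_anti; rewrite ubA lA//; apply/ubE.
have {AE} -> : A = oideal_sigma (\bigcup_(B in F) B) by exact: val_inj.
by split=> [|C /ubE //]; apply/ubE.
Qed.

End OIdealLattice.

Definition preserves_joins d d' (P : porderType d) (Q : porderType d')
    (f : P -> Q) : Prop :=
  forall (S : set P) (x : P), supremums S x -> supremums (f @` S) (f x).

Definition oideal_hat dK dL (K : latticeType dK) (L : latticeType dL)
    (T : K -> L) (A : OIdeal K) : OIdeal L :=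
  oideal_sigma (T @` A).

(* Main.v *)
Require Import Defs.
From mathcomp Require Import all_boot all_order.
From mathcomp Require Import boolp classical_sets cardinality.
Import Order.TTheory.
Set Implicit Arguments.
Unset Strict Implicit.
Unset Printing Implicit Defensive.
Local Open Scope order_scope.

(** Everything rests on one principle: the preimage of an O-closed ideal under
    a map that preserves existing joins is again an O-closed ideal
    ([O_closed_ideal_preimage]).  Among downsets, being O-closed only means
    being closed under directed suprema, because the lower witnesses of a
    convergent net lie below members of the net; and directed suprema are
    among the joins that the map preserves.

    Part (ii) applies the principle to [T]: with [J] the join of the ideals
    [oideal_hat T A], the preimage of [J] under [T] is an O-closed ideal
    containing every [A], hence also their join.

    Part (i) applies it to the maps [Order.meet x] of [L], whose preservation
    of joins is infinite distributivity.  If [J] contains all meets of an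
    element of [X] with an element of [Y], then the condition that [x] meets
    [y] inside [J] can be extended from [Y] to its closure, and then from [X]
    to its closure ([sigma_closureI_sub]).  For [X], [Y] the images of two
    ideals [A], [B] of [K], each such meet is the image of an element of the
    intersection of [A] and [B]. *)

Local Open Scope classical_set_scope.

(** The directed set, indexing itself, is a net that converges to its
    supremum; the supremum alone serves as the filtered set above it. *)
Lemma directed_sup_order_limits d (L : latticeType d) (D : set L) (x : L) :
  directed_for (fun a b => a <= b) D -> supremums D x -> order_limits D x.
Proof.
move=> dirD supx; have [[m0 Dm0] dirD'] := dirD.
exists {m | D m}, (fun i j => sval i <= sval j), sval; split.
- split=> [i|i j k|]; [exact: lexx | exact: le_trans |].
  split=> [|[i Di] [j Dj] _ _]; first by exists (exist _ m0 Dm0).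
  by have [k [Dk ik jk]] := dirD' _ _ Di Dj; exists (exist _ k Dk).
- by move=> [m Dm].
exists D, [set x]; split=> //.
- by split=> [|_ _ -> ->]; exists x.
- by rewrite infimums1.
move=> m n Dm ->; exists (exist _ m Dm) => -[i Di] /= mi.
by rewrite mi; apply: supx.1.
Qed.

(** The lower witnesses of a convergent net are eventually below the net. *)
Lemma order_limits_directed_sup d (L : latticeType d) (A : set L) (x : L) :
  (forall y z, z <= y -> A y -> A z) -> order_limits A x ->
  exists D : set L,
    [/\ D `<=` A, directed_for (fun a b => a <= b) D & supremums D x].
Proof.
move=> downA [I [R [u [[reflR _ _] Au [M [N [dirM [[n0 Nn0] _] supx _ uMN]]]]]]].
exists M; split=> // m Mm.
have [i0 mun] := uMN _ _ Mm Nn0.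
by have /andP[mu _] := mun _ (reflR i0); exact: downA mu (Au i0).
Qed.

(** Comparability is a join: [x <= y] says that [y] is the supremum of [x]
    and [y]. *)
Lemma preserves_joins_homo d d' (P : porderType d) (Q : porderType d')
    (f : P -> Q) :
  preserves_joins f -> {homo f : x y / x <= y}.
Proof.
move=> fj x y xy; have [+ _] : supremums (f @` [set x; y]) (f y).
  apply: fj; split=> [_ [] ->//|z ubz]; by apply: ubz; right.
by apply; exists x => //; left.
Qed.

Lemma O_closed_ideal_preimage d d' (K : latticeType d) (L : latticeType d')
    (f : K -> L) (J : set L) :
  preserves_joins f -> O_closed_ideal J -> O_closed_ideal (f @^-1` J).
Proof.
move=> fj [[downJ joinJ] closedJ]; have fle := preserves_joins_homo fj.
have downfJ y z : z <= y -> (f @^-1` J) y -> (f @^-1` J) z.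
  by move=> /fle; exact: downJ.
split; first split=> // F x finF FJ supx.
  apply: joinJ (fj _ _ supx); first exact: finite_image.
  by move=> _ [y Fy <-]; exact: FJ.
apply/seteqP; split=> [|x /(order_limits_directed_sup downfJ)[D [DJ dirD supx]]].
  exact: sub_order_limits.
rewrite /preimage /= closedJ.
apply: (order_limitsS (A := f @` D)) => [_ [m Dm <-]|]; first exact: DJ.
apply: directed_sup_order_limits (fj _ _ supx).
have [[m0 Dm0] dirD'] := dirD; split; first by exists (f m0), m0.
move=> _ _ [m Dm <-] [n Dn <-]; have [k [Dk mk nk]] := dirD' _ _ Dm Dn.
by exists (f k); split; [exists k | exact: fle | exact: fle].
Qed.

Lemma sigma_closureI_sub d (L : latticeType d) (X Y J : set L) :
  infinitely_distributive L -> O_closed_ideal J ->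
  (forall x y, X x -> Y y -> J (Order.meet x y)) ->
  sigma_closure X `&` sigma_closure Y `<=` J.
Proof.
move=> [distr _] JI XYJ.
have meetJ x : O_closed_ideal (Order.meet x @^-1` J).
  by apply: O_closed_ideal_preimage JI => S y; exact: distr.
have XsYJ x y : X x -> sigma_closure Y y -> J (Order.meet x y).
  by move=> Xx; apply: (sigma_min (meetJ x)) => z; exact: XYJ.
move=> z [sXz sYz]; rewrite -[z]meetxx.
by apply: (sigma_min (meetJ z)) sXz => x Xx /=; rewrite meetC; exact: XsYJ.
Qed.

Lemma oideal_hat_homo dK dL (K : latticeType dK) (L : latticeType dL)
    (T : K -> L) :
  {homo oideal_hat T : A B / A <= B}.
Proof.
move=> A B /le_oidealE AB; apply/oideal_sigma_le.
by move=> y /(image_subset T AB); exact: sub_sigma.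
Qed.

Lemma oideal_hatI dK dL (K : latticeType dK) (L : latticeType dL)
    (T : {lmorphism K -> L}) (A B : OIdeal K) :
  infinitely_distributive L ->
  oideal_hat T (Order.meet A B) = Order.meet (oideal_hat T A) (oideal_hat T B).
Proof.
move=> distrL; apply/le_anti/andP; split.
  by rewrite lexI !oideal_hat_homo ?leIl ?leIr.
apply/le_oidealE; apply: sigma_closureI_sub => //; first exact: oideal_closed.
move=> _ _ [a Aa <-] [b Bb <-]; rewrite -omorphI.
apply: sub_sigma; exists (Order.meet a b) => //.
have [[downA _] _] := oideal_closed A; have [[downB _] _] := oideal_closed B.
by split; [apply: downA Aa; exact: leIl | apply: downB Bb; exact: leIr].
Qed.

Lemma preserves_joins_oideal_hat dK dL (K : latticeType dK)
    (L : latticeType dL) (T : K -> L) :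
  preserves_joins T -> preserves_joins (oideal_hat T).
Proof.
move=> Tj F A supA; split=> [_ [B FB <-]|C ubC].
  by apply: oideal_hat_homo; exact: supA.1.
have TCI := O_closed_ideal_preimage Tj (oideal_closed C).
apply/oideal_sigma_le => _ [a Aa <-].
move: a Aa; rewrite ((oideal_supremums F A).1 supA).
apply: (sigma_min TCI) => b [B FB Bb].
have /oideal_sigma_le : oideal_hat T B <= C by apply: ubC; exists B.
by apply; exists b.
Qed.

Local Close Scope classical_set_scope.

Theorem theorem3p9 (dK dL : Order.disp_t)
    (K : latticeType dK) (L : latticeType dL) (T : {lmorphism K -> L}) :
  infinitely_distributive K -> infinitely_distributive L ->
  (forall A B : OIdeal K,
     oideal_hat T (Order.meet A B) = Order.meet (oideal_hat T A) (oideal_hat T B)) /\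
  (preserves_joins T -> preserves_joins (oideal_hat T)).
Proof.
move=> _ distrL; split=> [A B|]; first exact: oideal_hatI.
exact: preserves_joins_oideal_hat.
Qed.
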